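(* Let $R>0$, $\boldsymbol{\nu}\in X_R$ and $\boldsymbol{w}=(w^a)_{a\in A}\in\partial J(\boldsymbol{\nu})$. Define $\rho:=\int_A\nu^a\,d\mu(a)$, $G(x):=\rho((-\infty,x])$ and $G^-(x):=\rho((-\infty,x))$ for $x\in\mathbb{R}$. Then $$w^a(x)\in[G^-(x)-a,\;G(x)-a]\quad\text{for }\boldsymbol{\nu}\otimes\mu\text{-a.e. }(a,x).$$ In particular $\boldsymbol{w}\in L^\infty(\boldsymbol{\nu}\otimes\mu)$ with $\|\boldsymbol{w}\|_{L^\infty(\boldsymbol{\nu}\otimes\mu)}\le R_v+2$.
   Context: Setting. $R_x,R_v>0$. $f_0$ is a Borel probability measure on $\mathbb{R}^2$ supported in $[-R_x,R_x]\times[-R_v,R_v]$ with atomless first (spatial) marginal $\rho_0$; $G_0(x):=\rho_0((-\infty,x])$. $\eta_0$ is the push-forward of $f_0$ by $(x,v)\mapsto(x,v+G_0(x))$. $\mu$ is a fixed $\sigma$-finite Borel measure on $\mathbb{R}$ such that the second marginal of $\eta_0$ is absolutely continuous with respect to $\mu$, with density $h$; thus $h\ge0$, $\int h\,d\mu=1$ and $h=0$ outside $A:=[-R_v,R_v+1]$. Spaces. $X$ is the set of $\mu$-measurable families $\boldsymbol{\nu}=(\nu^a)_{a\in A}$ of nonnegative Borel measures on $\mathbb{R}$ with $\nu^a(\mathbb{R})=h(a)$ for $\mu$-a.e. $a$ and $\int_A\int x^2\,d\nu^a\,d\mu(a)<\infty$. For $R>0$, $X_R$ is the set of $\boldsymbol{\nu}\in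 X$ with $\mathrm{Supp}(\nu^a)\subset[-R,R]$ for $\mu$-a.e. $a$. $\boldsymbol{\nu}\otimes\mu$ denotes the probability measure $\int\phi\,d(\boldsymbol{\nu}\otimes\mu)=\int_A\int\phi(a,x)\,d\nu^a(x)\,d\mu(a)$. For measures of equal mass, $\Pi(\nu,\theta)$ is the set of nonnegative measures on the product with marginals $\nu,\theta$. $\boldsymbol{\gamma}\in\Pi(\boldsymbol{\nu},\boldsymbol{\theta})$ means $\boldsymbol{\gamma}=(\gamma^a)_{a\in A}$ is a $\mu$-measurable family with $\gamma^a\in\Pi(\nu^a,\theta^a)$. Energy. With $\overline{\boldsymbol{\nu}}:=\int_A\nu^a\,d\mu(a)$, $$J(\boldsymbol{\nu})=\frac14\int_{\mathbb{R}\times\mathbb{R}}|x-y|\,d\overline{\boldsymbol{\nu}}(x)\,d\overline{\boldsymbol{\nu}}(y)+\int_A\int_{\mathbb{R}}\left(\tfrac12-a\right)x\,d\nu^a(x)\,d\mu(a).$$ Subdifferential. For $\boldsymbol{\nu}\in X_R$, $\partial J(\boldsymbol{\nu})$ is the set of $\boldsymbol{w}=(w^a)_{a\in A}\in L^1(\boldsymbol{\nu}\otimes\mu)$ such that for all $R'>0$, $\boldsymbol{\theta}\in X_{R'}$ and $\boldsymbol{\gamma}\in\Pi(\boldsymbol{\nu},\boldsymbol{\theta})$: $J(\boldsymbol{\theta})-J(\boldsymbol{\nu})\ge\int_A\int w^a(y)(z-y)\,d\gamma^a(y,z)\,d\mu(a)$. *)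

(* Defs.v *)
From HB Require Import structures.
From mathcomp Require Import all_boot all_order all_algebra.
From mathcomp Require Import all_classical all_reals all_analysis.
From mathcomp Require Import measurable_realfun ess_sup_inf.

Set Implicit Arguments.
Unset Strict Implicit.
Unset Printing Implicit Defensive.
Import Order.TTheory GRing.Theory Num.Theory.
Import numFieldNormedType.Exports.

Local Open Scope classical_set_scope.
Local Open Scope ring_scope.

Section borel_measures.
Context {R : realType}.

Definition measure_supp {T : topologicalType} (m : set T -> \bar R) : set T :=
  [set x | forall U, open U -> U x -> (0 < m U)%E].

Definition atomless (m : set R -> \bar R) : Prop :=
  forall x, m [set x] = 0%E.

Definition cdf_of (m : set R -> \bar R) (x : R) : R := fine (m `]-oo, x]%classic).

Definition cdf_left_of (m : set R -> \bar R) (x : R) : R := fine (m `]-oo, x[%classic).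

Definition eta0 (f0 : probability (R * R)%type R) : set (R * R) -> \bar R :=
  let G0 := cdf_of (pushforward f0 fst) in
  pushforward f0 (fun p => (p.1, p.2 + G0 p.1)).

Definition vel_set (Rv : R) : set R := `[- Rv, Rv + 1]%classic.

Definition is_density (mu : {measure set R -> \bar R}) (m : set R -> \bar R)
    (h : R -> R) : Prop :=
  [/\ measurable_fun setT h, forall a, 0 <= h a &
      forall B, measurable B -> m B = (\int[mu]_(a in B) (h a)%:E)%E].

Definition is_coupling (g : set (R * R) -> \bar R) (m n : set R -> \bar R) :=
  forall B, measurable B ->
    pushforward g fst B = m B /\ pushforward g snd B = n B.

End borel_measures.

(* Measurability with respect to the mu-completion of the Borel sets of A: the
   function coincides mu-a.e. on A with a Borel function. *)
Definition mu_measurable {R : realType} (mu : {measure set R -> \bar R})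
    (A : set R) (f : R -> \bar R) : Prop :=
  exists2 g : R -> \bar R, measurable_fun A g & f = g %[ae mu in A].

(* mu-measurable families indexed by A; the values at a outside A play no role.
   Finiteness is automatic for families with nu^a(R) = h(a) and for families of
   couplings of these; it makes otimes below a measure. *)
Record mufamily {R : realType} (mu : {measure set R -> \bar R}) (Rv : R)
    {d} (T : measurableType d) := MuFamily {
  fam :> R -> {measure set T -> \bar R} ;
  fam_measurable : forall B, measurable B ->
    mu_measurable mu (vel_set Rv) (fun a => fam a B) ;
  fam_finite : \forall a \ae mu, vel_set Rv a -> (fam a setT < +oo)%E }.

Section ae_integral.
Local Open Scope ereal_scope.
Context {R : realType} (mu : {measure set R -> \bar R}) (A : set R).
Hypothesis mA : measurable A.

Import HBNNSimple.

(* The integral of a nonnegative function is a supremum over Borel simple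
   functions below it, so it is insensitive to null sets even when the functions
   are not Borel; on mu_measurable functions it is the integral against the
   completion of mu. *)
Lemma ge0_le_integral_ae (f g : R -> \bar R) :
  (forall x, A x -> 0 <= f x) -> (forall x, A x -> 0 <= g x) ->
  (\forall x \ae mu, A x -> f x <= g x) ->
  \int[mu]_(x in A) f x <= \int[mu]_(x in A) g x.
Proof.
move=> f0 g0 [N [mN N0 fgN]].
rewrite !ge0_integralE//; apply: ge_ereal_sup => _ [h /= hf <-].
have mNc : measurable (~` N) by exact: measurableC.
have hE x : proj_nnsfun h mNc x = (h \_ (~` N)) x by rewrite mrestrict.
apply: le_ereal_sup_tmp; exists (sintegral mu (proj_nnsfun h mNc)).
  exists (proj_nnsfun h mNc) => //= x.
  move: (hE x) => /= ->; rewrite patchE; case: ifPn => [|_].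
    rewrite inE => Nx; apply: (le_trans (hf x)); rewrite !patchE.
    case: ifPn => //; rewrite inE => Ax.
    apply: contrapT => h1; apply: Nx; apply: fgN => /= h2.
    by apply: h1; exact: h2.
  by rewrite patchE; case: ifPn => //; rewrite inE; exact: g0.
rewrite -mrestrict -integral_nnsfun//.
rewrite -integralT_nnsfun (@ge0_negligible_integral _ _ _ mu setT N)//.
- by rewrite setTD.
- exact/measurable_EFinP.
- by move=> x _; rewrite lee_fin.
Qed.

Lemma ge0_eq_integral_ae (f g : R -> \bar R) :
  (forall x, A x -> 0 <= f x) -> (forall x, A x -> 0 <= g x) ->
  f = g %[ae mu in A] ->
  \int[mu]_(x in A) f x = \int[mu]_(x in A) g x.
Proof.
move=> f0 g0 fg; apply/eqP; rewrite eq_le; apply/andP; split;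
  apply: ge0_le_integral_ae => //; apply: filterS fg => x + Ax => /(_ Ax) ->//.
Qed.

Lemma mu_measurable_nneseries (f : nat -> R -> \bar R) :
  (forall n a, A a -> 0 <= f n a) -> (forall n, mu_measurable mu A (f n)) ->
  mu_measurable mu A (fun a => \sum_(n <oo) f n a) /\
  (fun n => \sum_(0 <= i < n) \int[mu]_(a in A) f i a) @ \oo -->
  \int[mu]_(a in A) \sum_(n <oo) f n a.
Proof.
move=> f0 mf.
have [g0 g0P] : exists g : nat -> R -> \bar R, forall n,
    measurable_fun A (g n) /\ f n = g n %[ae mu in A].
  have /choice[g gP] n : exists g : R -> \bar R,
      measurable_fun A g /\ f n = g %[ae mu in A].
    by have [g mg fg] := mf n; exists g.
  by exists g.
pose g n a := `|g0 n a|.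
have mg n : measurable_fun A (g n).
  by apply: measurableT_comp => //; have [] := g0P n.
have fg n : f n = g n %[ae mu in A].
  have [_] := g0P n; apply: filterS => a + Aa => /(_ Aa) fga.
  by rewrite /g -fga gee0_abs// f0.
have fgs : (fun a => \sum_(n <oo) f n a) =
           (fun a => \sum_(n <oo) g n a) %[ae mu in A].
  have := ae_foralln fg; apply: filterS => a fga Aa.
  by apply: eq_eseriesr => n _; exact: fga.
split.
  exists (fun a => \sum_(n <oo) g n a) => //.
  by apply: ge0_emeasurable_sum => // n a Aa _; rewrite /g abse_ge0.
rewrite (ge0_eq_integral_ae _ _ fgs); last 2 first.
- by move=> a Aa; apply: nneseries_ge0 => n _ _; exact: f0.
- by move=> a Aa; apply: nneseries_ge0 => n _ _; exact: abse_ge0.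
rewrite integral_nneseries//; last by move=> n a _; exact: abse_ge0.
under eq_fun do under eq_bigr do
  rewrite (ge0_eq_integral_ae (f0 _) (fun a _ => abse_ge0 (g0 _ a)) (fg _)).
apply: is_cvg_nneseries => n _ _; apply: integral_ge0 => a _; exact: abse_ge0.
Qed.

End ae_integral.

Section families.
Local Open Scope ereal_scope.
Context {R : realType} (mu : {measure set R -> \bar R}) (Rv : R).
Local Notation A := (vel_set Rv).

Let mA : measurable A. Proof. exact: measurable_itv. Qed.

Definition marginal (nu : mufamily mu Rv R) (B : set R) : \bar R :=
  \int[mu]_(a in A) nu a B.

(* The measure nu (x) mu: its value at E is the iterated integral over A x R of
   the indicator of E. *)
Definition otimes (nu : mufamily mu Rv R) (E : set (R * R)) : \bar R :=
  \int[mu]_(a in A) nu a (xsection E a).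

Lemma mu_measurable_xsection (nu : mufamily mu Rv R) (E : set (R * R)) :
  measurable E -> mu_measurable mu A (fun a => nu a (xsection E a)).
Proof.
have mG := @measurable_prod_measurableType _ _ R R.
move=> mE; have := mE; rewrite {1}mG.
apply: (dynkin_induction (P := fun E =>
  mu_measurable mu A (fun a => nu a (xsection E a))) mG) => //.
- move=> _ _ [B1 mB1 [C1 mC1 <-]] [B2 mB2 [C2 mC2 <-]].
  exists (B1 `&` B2); first exact: measurableI.
  by exists (C1 `&` C2); [exact: measurableI|rewrite setXI].
- have [g mg fg] := fam_measurable nu measurableT.
  exists g => //; apply: filterS fg => a + Aa => /(_ Aa) <-.
  by rewrite xsectionE preimage_setT.
- move=> _ [B mB [C mC <-]].
  have [g mg fg] := fam_measurable nu mC.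
  exists (fun a => (\1_B a)%:E * g a).
    by apply: emeasurable_funM => //; apply/measurable_EFinP.
  apply: filterS fg => a + Aa => /(_ Aa) <-.
  rewrite indicE; have [aB|aB] := boolP (a \in B).
    by rewrite mul1e in_xsectionX.
  by rewrite mul0e notin_xsectionX// measure0.
- move=> S mS [g mg fg].
  have [k mk fk] := fam_measurable nu measurableT.
  exists (fun a => k a - g a); first exact: emeasurable_funB.
  move: (fam_finite nu) fg fk; apply: filterS3 => a fin fg fk Aa.
  have -> : xsection (~` S) a = setT `\` xsection S a.
    by rewrite setTD !xsectionE preimage_setC.
  rewrite -(fg Aa) -(fk Aa) measureD//.
  - by rewrite setTI.
  - exact: measurable_xsection.
  - exact: fin.
- move=> F mF tF hF.
  have [+ _] := @mu_measurable_nneseries _ mu A mA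
    (fun n a => nu a (xsection (F n) a)) (fun n a _ => measure_ge0 _ _) hF.
  case=> g mg fg; exists g => //; apply: filterS fg => a + Aa => /(_ Aa) <-.
  rewrite xsection_bigcup measure_semi_bigcup//.
  - by move=> n; exact: measurable_xsection.
  - exact: trivIset_xsection.
  - by apply: bigcup_measurable => n _; exact: measurable_xsection.
Qed.

Let marginal0 nu : marginal nu set0 = 0.
Proof. by rewrite /marginal integral0_eq. Qed.

Let marginal_ge0 nu B : 0 <= marginal nu B.
Proof. by apply: integral_ge0. Qed.

Let marginal_sigma_additive nu : semi_sigma_additive (marginal nu).
Proof.
move=> F mF tF mUF; rewrite /marginal.
have [_] := @mu_measurable_nneseries _ mu A mA (fun n a => nu a (F n))
  (fun n a _ => measure_ge0 _ _) (fun n => fam_measurable nu (mF n)).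
congr (_ --> _); apply: eq_integral => a _.
by rewrite measure_semi_bigcup.
Qed.

HB.instance Definition _ nu := isMeasure.Build _ _ _ (marginal nu)
  (marginal0 nu) (marginal_ge0 nu) (@marginal_sigma_additive nu).

Let otimes0 nu : otimes nu set0 = 0.
Proof. by rewrite /otimes integral0_eq// => a _; rewrite xsection0. Qed.

Let otimes_ge0 nu E : 0 <= otimes nu E.
Proof. by apply: integral_ge0. Qed.

Let otimes_sigma_additive nu : semi_sigma_additive (otimes nu).
Proof.
move=> F mF tF mUF; rewrite /otimes.
have [_] := @mu_measurable_nneseries _ mu A mA
  (fun n a => nu a (xsection (F n) a)) (fun n a _ => measure_ge0 _ _)
  (fun n => mu_measurable_xsection nu (mF n)).
congr (_ --> _); apply: eq_integral => a _.
rewrite xsection_bigcup measure_semi_bigcup//.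
- by move=> n; exact: measurable_xsection.
- exact: trivIset_xsection.
- by apply: bigcup_measurable => n _; exact: measurable_xsection.
Qed.

HB.instance Definition _ nu := isMeasure.Build _ _ _ (otimes nu)
  (otimes0 nu) (otimes_ge0 nu) (@otimes_sigma_additive nu).

End families.

Section subdifferential.
Local Open Scope ereal_scope.
Context {R : realType} (mu : {measure set R -> \bar R}) (Rv : R).
Local Notation A := (vel_set Rv).

Definition X_space (h : R -> R) : set (mufamily mu Rv R) :=
  [set nu : mufamily mu Rv R |
    (\forall a \ae mu, A a -> nu a setT = (h a)%:E) /\
    \int[mu]_(a in A) \int[nu a]_x (x ^+ 2)%:E < +oo].

Definition X_ball (h : R -> R) (r : R) : set (mufamily mu Rv R) :=
  [set nu : mufamily mu Rv R |
    X_space h nu /\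
    \forall a \ae mu, A a -> measure_supp (nu a) `<=` `[(- r)%R, r]%classic].

Definition coupling_family (nu theta : mufamily mu Rv R) :
    set (mufamily mu Rv (R * R)%type) :=
  [set g : mufamily mu Rv (R * R)%type |
    \forall a \ae mu, A a -> is_coupling (g a) (nu a) (theta a)].

Definition energy (nu : mufamily mu Rv R) : \bar R :=
  (4^-1)%:E * \int[marginal nu]_x \int[marginal nu]_y `|x - y|%:E +
  \int[mu]_(a in A) \int[nu a]_x ((2^-1 - a) * x)%:E.

(* An element (w^a)_a of L^1(nu (x) mu) is given by a Borel representative
   (a, x) |-> w^a(x) on R^2; only its values on A x R matter, as otimes nu
   vanishes outside A x R. *)
Definition subdifferential (h : R -> R) (nu : mufamily mu Rv R) :
    set (R * R -> R) :=
  [set w : R * R -> R | w \in Lfun (otimes nu) 1 /\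
    forall (r : R) (theta : mufamily mu Rv R) (g : mufamily mu Rv (R * R)%type),
      (0 < r)%R -> X_ball h r theta -> coupling_family nu theta g ->
      \int[mu]_(a in A) \int[g a]_p (w (a, p.1) * (p.2 - p.1))%:E
        <= energy theta - energy nu].

End subdifferential.

(* Main.v *)
(* Perturb nu by a shift: for a Borel set E and a real s, move the mass at (a, x) in
   E to (a, x + s), keeping the rest.  With M = nu (x) mu, xi = x + s 1_E(a, x) and
   b(x, y) = s (2 1_{y < x + s} - 1), convexity of the absolute value gives, for
   either sign of s,
     |xi - eta| <= |x - y| + 1_E(a, x) b(x, y) + 1_E(a', y) b(y, x).
   Integrating against M (x) M, the energy grows by at most
   s \int_E (G^-(x + s) - a) dM, so the subdifferential inequality for this
   perturbation reads s \int_E w dM <= s \int_E (G^-(x + s) - a) dM.  As E is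
   arbitrary, s w^a(x) <= s (G^-(x + s) - a) M-a.e.  Taking s = 1/n and s = -1/n and
   letting n tend to infinity yields the two bounds. *)
Require Import Defs.
From HB Require Import structures.
From mathcomp Require Import all_boot all_order all_algebra.
From mathcomp Require Import all_classical all_reals all_analysis.
From mathcomp Require Import measurable_realfun ess_sup_inf.
From mathcomp Require Import ring lra.

Set Implicit Arguments.
Unset Strict Implicit.
Unset Printing Implicit Defensive.
Import Order.TTheory GRing.Theory Num.Theory.
Import numFieldNormedType.Exports.

Local Open Scope classical_set_scope.
Local Open Scope ring_scope.

(** * Integration over A of functions measurable for the completion of mu *)

Section mu_measurable_theory.
Local Open Scope ereal_scope.
Context {R : realType} (mu : {measure set R -> \bar R}) (A : set R).
Hypothesis mA : measurable A.
Implicit Types f g : R -> \bar R.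

Lemma eq_integral_ae f g : f = g %[ae mu in A] ->
  \int[mu]_(x in A) f x = \int[mu]_(x in A) g x.
Proof.
move=> fg; rewrite [LHS]integralE [RHS]integralE; congr (_ - _);
  apply: ge0_eq_integral_ae => //; apply: filterS fg => x + Ax => /(_ Ax) fgx.
- by rewrite !funeposE fgx.
- by rewrite !funenegE fgx.
Qed.

Lemma mu_measurable_ge0 f : (forall a, A a -> 0 <= f a) -> mu_measurable mu A f ->
  exists g, [/\ measurable_fun A g, forall a, 0 <= g a & f = g %[ae mu in A]].
Proof.
move=> f0 [g mg fg]; exists (abse \o g); split => //.
- exact: measurableT_comp.
- by move=> a; exact: abse_ge0.
- by apply: filterS fg => a + Aa => /(_ Aa) fga /=; rewrite -fga gee0_abs// f0.
Qed.

Lemma mu_measurableD f g : mu_measurable mu A f -> mu_measurable mu A g ->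
  mu_measurable mu A (f \+ g).
Proof.
move=> [f' mf ff] [g' mg gg]; exists (f' \+ g'); first exact: emeasurable_funD.
by apply: filterS2 ff gg => a + + Aa => /(_ Aa) fa /(_ Aa) ga /=; rewrite fa ga.
Qed.

Lemma mu_measurableZ (c : R) f : mu_measurable mu A f ->
  mu_measurable mu A (fun a => c%:E * f a).
Proof.
move=> [f' mf ff]; exists (fun a => c%:E * f' a); first exact: measurable_funeM.
by apply: filterS ff => a + Aa => /(_ Aa) ->.
Qed.

(** Both integrands are replaced by nonnegative Borel representatives, which changes them on a null
    set only and so leaves the integrals alone. The rules for scalar multiples and differences below
    are transferred in the same way. *)
Lemma mu_measurable_ge0_integralD f g :
  (forall a, A a -> 0 <= f a) -> mu_measurable mu A f ->
  (forall a, A a -> 0 <= g a) -> mu_measurable mu A g ->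
  \int[mu]_(a in A) (f a + g a) =
  \int[mu]_(a in A) f a + \int[mu]_(a in A) g a.
Proof.
move=> f0 /(mu_measurable_ge0 f0)[f' [mf' f'0 ff]].
move=> g0 /(mu_measurable_ge0 g0)[g' [mg' g'0 gg]].
rewrite (eq_integral_ae ff) (eq_integral_ae gg) -ge0_integralD//.
apply: eq_integral_ae; apply: filterS2 ff gg => a + + Aa.
by move=> /(_ Aa) -> /(_ Aa) ->.
Qed.

Lemma mu_measurable_ge0_integralZ (c : R) f : (0 <= c)%R ->
  (forall a, A a -> 0 <= f a) -> mu_measurable mu A f ->
  \int[mu]_(a in A) (c%:E * f a) = c%:E * \int[mu]_(a in A) f a.
Proof.
move=> c0 f0 /(mu_measurable_ge0 f0)[f' [mf' f'0 ff]].
rewrite (eq_integral_ae ff) -ge0_integralZl_EFin//.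
by apply: eq_integral_ae; apply: filterS ff => a + Aa => /(_ Aa) ->.
Qed.

Lemma mu_measurable_integralB f g :
  (forall a, A a -> 0 <= f a) -> mu_measurable mu A f ->
  (forall a, A a -> 0 <= g a) -> mu_measurable mu A g ->
  \int[mu]_(a in A) f a < +oo -> \int[mu]_(a in A) g a < +oo ->
  \int[mu]_(a in A) (f a - g a) =
  \int[mu]_(a in A) f a - \int[mu]_(a in A) g a.
Proof.
move=> f0 /(mu_measurable_ge0 f0)[f' [mf' f'0 ff]].
move=> g0 /(mu_measurable_ge0 g0)[g' [mg' g'0 gg]].
rewrite (eq_integral_ae ff) (eq_integral_ae gg) => foo goo.
rewrite -integralB//; last 2 first.
- apply/integrableP; split => //.
  by under eq_integral do rewrite gee0_abs//.
- apply/integrableP; split => //.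
  by under eq_integral do rewrite gee0_abs//.
apply: eq_integral_ae; apply: filterS2 ff gg => a + + Aa.
by move=> /(_ Aa) -> /(_ Aa) ->.
Qed.

Lemma mu_measurable_ge0_sum (I : Type) (s : seq I) (f : I -> R -> \bar R) :
  (forall i a, A a -> 0 <= f i a) -> (forall i, mu_measurable mu A (f i)) ->
  mu_measurable mu A (fun a => \sum_(i <- s) f i a) /\
  \int[mu]_(a in A) (\sum_(i <- s) f i a) =
  \sum_(i <- s) \int[mu]_(a in A) f i a.
Proof.
move=> f0 mf; elim: s => [|i s [ihm ih]].
  split; last by under eq_integral do rewrite big_nil; rewrite big_nil integral0.
  by exists (cst 0) => //; apply: aeW => a _; rewrite big_nil.
split.
  rewrite (_ : (fun a => _) = f i \+ (fun a => \sum_(j <- s) f j a)).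
    exact: mu_measurableD.
  by apply/funext => a; rewrite big_cons.
under eq_integral do rewrite big_cons.
rewrite big_cons -ih mu_measurable_ge0_integralD//; first exact: f0.
by move=> a Aa; apply: sume_ge0 => j _; exact: f0.
Qed.

Lemma mu_measurable_monotone_limit (f : nat -> R -> \bar R) g :
  (forall n a, A a -> 0 <= f n a) -> (forall n, mu_measurable mu A (f n)) ->
  (forall a, A a -> nondecreasing_seq (f ^~ a)) ->
  (forall a, A a -> f ^~ a @ \oo --> g a) ->
  mu_measurable mu A g /\
  (fun n => \int[mu]_(a in A) f n a) @ \oo --> \int[mu]_(a in A) g a.
Proof.
move=> f0 mf ndf fg.
have /choice[f' f'P] n : exists f', [/\ measurable_fun A f',
    forall a, 0 <= f' a & f n = f' %[ae mu in A]].
  exact: mu_measurable_ge0 (f0 n) (mf n).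
have [N [mN N0 ffN]] := ae_foralln (fun n => let: And3 _ _ h := f'P n in h).
have offN a : A a -> ~ N a -> forall n, f n a = f' n a.
  by move=> Aa Na n; apply: contrapT => h; apply: Na; apply: ffN => /(_ n Aa).
(* The representatives [f' n] are monotone in n only off a null set. Setting all of them to 0 on one
   Borel null set N, which contains every exceptional set, makes the sequence monotone everywhere on
   A. *)
pose k n := f' n \_ (~` N).
have fk n : f n = k n %[ae mu in A].
  exists N; split => // a /= /not_implyP[Aa]; apply: contra_notP => Na.
  by rewrite /k patchE mem_set// offN.
have k0 n a : 0 <= k n a.
  by rewrite /k patchE; case: ifPn => // _; have [] := f'P n.
have mk n : measurable_fun A (k n).
  have [mf' _ _] := f'P n; apply/measurable_restrict => //.
    exact: measurableC.
  by apply: measurable_funS mf' => //; exact: subIsetl.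
have ndk a : A a -> nondecreasing_seq (k ^~ a).
  move=> Aa m n mn; rewrite /k !patchE; case: ifPn => // /set_mem Na.
  by rewrite -!offN//; exact: ndf.
have gk : g = (fun a => limn (k ^~ a)) %[ae mu in A].
  exists N; split => // a /= /not_implyP[Aa]; apply: contra_notP => Na.
  apply/esym/cvg_lim => //.
  rewrite (_ : k ^~ a = f ^~ a); first exact: fg.
  by apply/funext => n; rewrite /k patchE mem_set// offN.
have cvgk a : A a -> k ^~ a @ \oo --> limn (k ^~ a).
  by move=> Aa; apply: ereal_nondecreasing_is_cvgn; exact: ndk.
split; first by exists (fun a => limn (k ^~ a)) => //; exact: emeasurable_fun_cvg mk cvgk.
rewrite (eq_integral_ae gk).
under eq_fun do rewrite (eq_integral_ae (fk _)).
by apply: cvg_monotone_convergence => // n a _; exact: k0.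
Qed.
End mu_measurable_theory.

(** * Integration against a mixture M of measures K a *)

Section mixture.
Local Open Scope ereal_scope.
Context {R : realType} (mu : {measure set R -> \bar R}) (A : set R).
Hypothesis mA : measurable A.
Context {d} {T : measurableType d} (K : R -> {measure set T -> \bar R})
  (M : {measure set T -> \bar R}).
Hypothesis mK : forall B, measurable B -> mu_measurable mu A (fun a => K a B).
Hypothesis KM : forall B, measurable B -> \int[mu]_(a in A) K a B = M B.

Import HBNNSimple.

(** First stage of the usual approximation argument: the integral of a simple function is a finite
    sum over its values, so only finite additivity in mu is involved. *)
Lemma mixture_nnsfun (f : {nnsfun T >-> R}) :
  mu_measurable mu A (fun a => \int[K a]_x (f x)%:E) /\
  \int[mu]_(a in A) \int[K a]_x (f x)%:E = \int[M]_x (f x)%:E.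
Proof.
pose s := finmap.enum_fset (fset_set (range f)).
have intE (m : {measure set T -> \bar R}) : \int[m]_x (f x)%:E =
    \sum_(y <- s) y%:E * m (f @^-1` [set y]).
  by rewrite integralT_nnsfun sintegralE fsbig_finite//=; exact: fimfunP.
have f0 y (m : {measure set T -> \bar R}) : 0 <= y%:E * m (f @^-1` [set y]).
  exact: nnsfun_mulemu_ge0.
have mf y : measurable (f @^-1` [set y]) by exact: measurable_sfunP.
have [|y|mI II] := @mu_measurable_ge0_sum _ mu A mA _ s
  (fun y a => y%:E * K a (f @^-1` [set y])).
- by move=> y a _.
- by apply: mu_measurableZ; exact: mK.
rewrite (_ : (fun a => \int[K a]_x (f x)%:E) =
    fun a => \sum_(y <- s) y%:E * K a (f @^-1` [set y])); last first.
  by apply/funext => a; exact: intE.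
split => //; rewrite II intE; apply: eq_bigr => y _.
have [y0|y0] := leP 0%R y.
  by rewrite mu_measurable_ge0_integralZ// ?KM//; exact: mK.
(* A negative y is not a value of f, so both sides vanish. *)
rewrite preimage_nnfun0// measure0 mule0.
by under eq_integral do rewrite measure0 mule0; rewrite integral0.
Qed.

(** Simple functions increase to f; monotone convergence is applied under each [K a], under M, and
    then in a. The last passage is the one that needs the version for the completion of mu. *)
Lemma mixture_ge0 (f : T -> \bar R) :
  measurable_fun setT f -> (forall x, 0 <= f x) ->
  mu_measurable mu A (fun a => \int[K a]_x f x) /\
  \int[mu]_(a in A) \int[K a]_x f x = \int[M]_x f x.
Proof.
move=> mf f0; pose f_ := nnsfun_approx measurableT mf.
have ndf x : nondecreasing_seq (fun n => (f_ n x)%:E).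
  by move=> m n mn; rewrite lee_fin; exact/lefP/nd_nnsfun_approx.
have cvgf (m : {measure set T -> \bar R}) :
    (fun n => \int[m]_x (f_ n x)%:E) @ \oo --> \int[m]_x f x.
  rewrite (_ : \int[m]_x f x = \int[m]_x limn (fun n => (f_ n x)%:E)).
    apply: cvg_monotone_convergence => //.
    - by move=> n; exact/measurable_EFinP.
    - by move=> n x _; rewrite lee_fin.
  apply: eq_integral => x _; apply/esym/cvg_lim => //.
  exact: cvg_nnsfun_approx.
have [||||mI II] := @mu_measurable_monotone_limit _ mu A mA
    (fun n a => \int[K a]_x (f_ n x)%:E) (fun a => \int[K a]_x f x).
- by move=> n a _; apply: integral_ge0 => x _; rewrite lee_fin.
- by move=> n; exact: (mixture_nnsfun (f_ n)).1.
- move=> a _ m n mn; apply: ge0_le_integral => //.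
  + by move=> x _; rewrite lee_fin.
  + exact/measurable_EFinP.
  + exact/measurable_EFinP.
  + by move=> x _; exact: ndf.
- by move=> a _; exact: cvgf.
split => //; rewrite -(cvg_lim _ II)//; apply/cvg_lim => //.
rewrite (_ : (fun n => _) = (fun n => \int[M]_x (f_ n x)%:E)); first exact: cvgf.
by apply/funext => n; exact: (mixture_nnsfun (f_ n)).2.
Qed.

(** Split into positive and negative parts. Integrability against M makes both iterated integrals
    finite, so they may be subtracted under the integral in a. *)
Lemma mixture_integrable (f : T -> \bar R) : M.-integrable setT f ->
  \int[mu]_(a in A) \int[K a]_x f x = \int[M]_x f x.
Proof.
move=> intf; have mf := measurable_int _ intf.
have mfp : measurable_fun setT f^\+ by exact: measurable_funepos.
have mfn : measurable_fun setT f^\- by exact: measurable_funeneg.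
have [mp ip] := mixture_ge0 mfp (funepos_ge0 f).
have [mn inn] := mixture_ge0 mfn (funeneg_ge0 f).
rewrite [RHS]integralE -ip -inn.
under eq_integral do rewrite integralE.
rewrite mu_measurable_integralB//.
- by move=> a _; exact: integral_ge0.
- by move=> a _; exact: integral_ge0.
- by rewrite ip; exact: integrable_lty (integrable_funepos _ intf).
- by rewrite inn; exact: integrable_lty (integrable_funeneg _ intf).
Qed.

End mixture.

(** * First variation of the energy under a shift, on an abstract space *)

Section potential_energy.
Local Open Scope ereal_scope.
Context {R : realType} {d} {T : measurableType d} (m : set T -> \bar R).

(** For nu (x) mu and x the second projection, this is G^- at [p.2 + s]; the strict inequality is
    what produces the left limit G^-. *)
Definition below_mass (x : T -> R) (s : R) (p : T) : R :=
  fine (m [set q | (x q < x p + s)%R]).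

Definition interaction (y : T -> R) : \bar R :=
  \int[m]_p \int[m]_q `|y p - y q|%:E.

(* This is the energy of the paper when m is nu (x) mu, y the second projection
   and c (a, x) = 1/2 - a. *)
Definition potential_energy (c y : T -> R) : \bar R :=
  4^-1%:E * interaction y + \int[m]_p (c p * y p)%:E.

End potential_energy.

Section shift_variation.
Local Open Scope ereal_scope.
Context {R : realType} {d} {T : measurableType d}.
Variables (P : {finite_measure set T -> \bar R}) (x : T -> R) (s : R).
Hypotheses (PT : P setT = 1) (ix : P.-integrable setT (EFin \o x)).

Let mx : measurable_fun setT x.
Proof. by apply/measurable_EFinP; exact: measurable_int ix. Qed.

Let W := [set z : T * T | (x z.2 < x z.1 + s)%R].

Let mW : measurable W.
Proof.
have mf : measurable_fun setT (fun z : T * T => (x z.2 < x z.1 + s)%R).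
  apply: measurable_fun_ltr; first exact: measurableT_comp.
  by apply: measurable_funD => //; exact: measurableT_comp.
by have := mf measurableT [set true] I; rewrite setTI.
Qed.

Local Notation below_mass := (below_mass P x s).
Local Notation interaction := (interaction P).
Local Notation potential_energy := (potential_energy P).

Let below_massE p : P [set q | (x q < x p + s)%R] = (below_mass p)%:E.
Proof.
rewrite fineK// fin_num_measure//.
by have := measurable_xsection p mW; rewrite xsectionE.
Qed.

Lemma below_mass01 p : (0 <= below_mass p <= 1)%R.
Proof.
have mS : measurable [set q | (x q < x p + s)%R].
  by have := measurable_xsection p mW; rewrite xsectionE.
rewrite -!lee_fin -below_massE measure_ge0/= -PT.
by apply: le_measure => //; rewrite inE.
Qed.

Lemma measurable_below_mass : measurable_fun setT below_mass.
Proof.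
apply: measurableT_comp => //.
have := measurable_fun_xsection P mW.
by apply: eq_measurable_fun => p _ /=; rewrite xsectionE.
Qed.

(** Put u = x p - x q. The factor 2 1_W(p, q) - 1 is a subgradient of the absolute value at u + s,
    so |u + s| <= |u| + s (2 1_W(p, q) - 1). This is the case where only p moves; the case of q is
    symmetric. If both move, the distance is unchanged and the correction is nonnegative: u + s and
    s - u add up to 2 s, so one of them has the sign of s. *)
Lemma shift_variation_pointwise (E : set T) (p q : T) :
  (`|x p + s * \1_E p - (x q + s * \1_E q)| <= `|x p - x q| +
    (\1_E p * (s * (2 * \1_W (p, q) - 1)) +
     \1_E q * (s * (2 * \1_W (q, p) - 1))))%R.
Proof.
rewrite !indicE (_ : ((p, q) \in W) = (x q < x p + s)%R); last first.
  by apply/idP/idP; rewrite inE.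
rewrite (_ : ((q, p) \in W) = (x p < x q + s)%R); last first.
  by apply/idP/idP; rewrite inE.
case: (p \in E); case: (q \in E); case: ltP => h1; case: ltP => h2;
  case: (ger0P (x p - x q)) => h3;
  rewrite ?(mulr1, mulr0, mul1r, mul0r, addr0, add0r) /=;
  rewrite ler_norml; apply/andP; split; lra.
Qed.

Let b (E : set T) (z : T * T) : R := (\1_E z.1 * (s * (2 * \1_W z - 1)))%R.

Let mb E : measurable E -> measurable_fun setT (b E).
Proof.
move=> mE; apply: measurable_funM.
  apply: measurableT_comp => //; exact: measurable_indic.
apply: measurable_funM => //; apply: measurable_funB => //.
by apply: measurable_funM => //; exact: measurable_indic.
Qed.

Let b_bounded E z : (`|b E z| <= `|s|)%R.
Proof.
rewrite /b !indicE; case: (_ \in _); case: (_ \in _);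
  rewrite ?(mulr1, mulr0, mul1r, mul0r, normr0)//= normrM ler_piMr// ler_norml;
  apply/andP; split; lra.
Qed.

Let integral_cstP (k : R) : \int[P]_q k%:E = k%:E.
Proof. by rewrite integral_cst//= -[RHS]mule1; congr (_ * _); exact: PT. Qed.

Let integrable_cstP k : P.-integrable setT (EFin \o cst k).
Proof. exact: finite_measure_integrable_cst. Qed.

(** By Tonelli and P(T) = 1, the integral of |f| is at most the sum of the integrals of |g| and
    |h|. *)
Let integrable_prod (f : T * T -> R) (g h : T -> R) : measurable_fun setT f ->
  P.-integrable setT (EFin \o g) -> P.-integrable setT (EFin \o h) ->
  (forall p q, `|f (p, q)| <= `|g p| + `|h q|)%R ->
  (P \x P).-integrable setT (EFin \o f).
Proof.
move=> mf ig ih fgh; apply/integrable12ltyP; first exact/measurable_EFinP.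
have ig' := integrable_abse ig; have ih' := integrable_abse ih.
pose c := \int[P]_q `|(h q)%:E|.
have cfin : c \is a fin_num by exact: integrable_fin_num ih'.
apply: (@le_lt_trans _ _ (\int[P]_p (`|(g p)%:E| + c))).
  apply: ge0_le_integral => //.
  - by move=> p _; apply: integral_ge0.
  - apply: (measurable_fun_fubini_tonelli_F (abse \o (EFin \o f))) => //=.
    by apply: measurableT_comp => //; exact/measurable_EFinP.
  - by apply: emeasurable_funD => //; exact: measurable_int ig'.
  - move=> p _; rewrite [X in _ <= X + _](_ : _ = \int[P]_q `|g p|%:E); last first.
      by rewrite integral_cstP.
    rewrite /c -integralD//; last exact: finite_measure_integrable_cst.
    apply: ge0_le_integral => //.
    + apply: measurableT_comp => //; apply/measurable_EFinP.
      by apply: measurableT_comp => //; exact: measurable_pair1.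
    + apply: emeasurable_funD => //; exact: measurable_int ih'.
    + by move=> q _ /=; rewrite -EFinD lee_fin.
rewrite integralD//; last first.
  by rewrite -(fineK cfin); exact: finite_measure_integrable_cst.
rewrite -(fineK cfin) integral_cstP lte_add_pinfty//; last exact: ltry.
exact: integrable_lty ig'.
Qed.

Lemma integrable_dist (y : T -> R) : P.-integrable setT (EFin \o y) ->
  (P \x P).-integrable setT (fun z => `|y z.1 - y z.2|%:E).
Proof.
move=> iy; have my : measurable_fun setT y.
  by apply/measurable_EFinP; exact: measurable_int iy.
apply: (integrable_prod _ iy iy) => /=.
  apply: measurableT_comp => //; apply: measurable_funB;
    exact: measurableT_comp.
by move=> p q; rewrite normr_id; exact: ler_normB.
Qed.

Lemma interactionE (y : T -> R) : P.-integrable setT (EFin \o y) ->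
  interaction y = \int[P \x P]_z `|y z.1 - y z.2|%:E.
Proof. by move=> /integrable_dist iy; rewrite -integral12_prod_meas1. Qed.

Lemma interaction_fin_num (y : T -> R) : P.-integrable setT (EFin \o y) ->
  interaction y \is a fin_num.
Proof.
move=> iy; rewrite interactionE//.
exact: integrable_fin_num (integrable_dist iy).
Qed.

Let integrable_b E : measurable E -> (P \x P).-integrable setT (EFin \o b E).
Proof.
move=> mE; apply: (@integrable_prod _ (cst s) (cst 0%R) (mb mE)) => // p q.
by rewrite /= normr0 addr0; exact: b_bounded.
Qed.

Let integrable_bC E : measurable E ->
  (P \x P).-integrable setT (fun z => (b E (z.2, z.1))%:E).
Proof.
move=> mE; apply: (@integrable_prod (fun z => b E (z.2, z.1)) (cst s)
  (cst 0%R)) => // [|p q].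
  rewrite -[X in measurable_fun _ X]/(b E \o (fun z => (z.2, z.1))).
  by apply: measurableT_comp (mb mE) _; exact: measurable_fun_pair.
by rewrite /= normr0 addr0; exact: b_bounded.
Qed.

(** For fixed p, [b E] is affine in the indicator of the section of W at p, and that section has
    mass [below_mass p]. *)
Let integral_b E p : measurable E ->
  \int[P]_q (b E (p, q))%:E = (\1_E p * (s * (2 * below_mass p - 1)))%:E.
Proof.
move=> mE; have mWp : measurable (xsection W p) by exact: measurable_xsection.
pose k : R := (\1_E p * s)%R.
transitivity (\int[P]_q ((- k)%:E + (2 * k)%:E * (\1_(xsection W p) q)%:E)).
  apply: eq_integral => q _; rewrite -EFinM -EFinD; congr EFin.
  rewrite /b /k /= (_ : \1_W (p, q) = \1_(xsection W p) q :> R); first by ring.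
  by rewrite !indicE mem_xsection.
rewrite integralD//; last 2 first.
- exact: integrable_cstP.
- by apply: integrableZl => //; exact: integrable_indic.
rewrite integral_cstP integralZl//; last exact: integrable_indic.
rewrite integral_indic// setIT.
rewrite [X in _ + _ * X](_ : _ = (below_mass p)%:E); last first.
  by rewrite xsectionE; exact: below_massE.
rewrite -EFinM -EFinD.
by congr EFin; rewrite /k; ring.
Qed.

Lemma integrable_shift E : measurable E ->
  P.-integrable setT (EFin \o (fun p => x p + s * \1_E p)%R).
Proof.
move=> mE; rewrite (_ : _ \o _ = (EFin \o x) \+ (fun p => s%:E * (\1_E p)%:E)).
  apply: integrableD => //.
  by apply: integrableZl => //; exact: integrable_indic.
by apply/funext => p /=; rewrite EFinD EFinM.
Qed.

(** The pointwise inequality is integrated over P x P. The two correction terms are exchanged by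
    swapping the coordinates, which accounts for the factor 2. *)
Lemma interaction_shift E : measurable E ->
  interaction (fun p => x p + s * \1_E p)%R <= interaction x +
    2%:E * \int[P]_p (\1_E p * (s * (2 * below_mass p - 1)))%:E.
Proof.
move=> mE.
have ixE : P.-integrable setT (EFin \o (fun p => x p + s * \1_E p)%R).
  exact: integrable_shift.
rewrite !interactionE//.
have iD := integrable_dist ix.
have ibb := integrableD measurableT (integrable_b mE) (integrable_bC mE).
apply: (@le_trans _ _ (\int[P \x P]_z (`|x z.1 - x z.2|%:E +
    ((b E z)%:E + (b E (z.2, z.1))%:E)))).
  apply: (le_integral measurableT (integrable_dist ixE)) => //.
  - exact: integrableD.
  - by move=> [p q] _ /=; rewrite -!EFinD lee_fin shift_variation_pointwise.
rewrite integralD// integralD//; [|exact: integrable_b|exact: integrable_bC].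
rewrite leeD2l//.
(* The swapped term is integrated in the opposite order, so that both inner integrals are given by
   [integral_b]. *)
rewrite -[X in _ + X]integral21_prod_meas1; last exact: integrable_bC.
rewrite -[X in X + _]integral12_prod_meas1; last exact: integrable_b.
rewrite /fubini_F /fubini_G /=.
under [X in X + _ <= _]eq_integral do rewrite integral_b//.
under [X in _ + X <= _]eq_integral do rewrite integral_b//.
by rewrite -[leRHS]/(2%:R%:E * _) mule_natl mule2n.
Qed.

(** The hypothesis is tested on the set E where the claimed inequality fails, that is where its
    defect k is positive. It then bounds the integral of k over E by 0, so E is null. *)
Lemma ae_le_of_shift_variation_finite (c w : T -> R) :
  P.-integrable setT (EFin \o c) ->
  P.-integrable setT (EFin \o (c \* x)%R) ->
  P.-integrable setT (EFin \o w) ->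
  (forall E, measurable E -> \int[P]_p (w p * (s * \1_E p))%:E <=
    potential_energy c (fun p => x p + s * \1_E p)%R - potential_energy c x) ->
  \forall p \ae P, (s * w p <= s * (below_mass p + c p - 2^-1))%R.
Proof.
move=> ic icx iw H.
pose k p : R := (s * w p - s * (below_mass p + c p - 2^-1))%R.
have ibm : P.-integrable setT (EFin \o below_mass).
  apply: (le_integrable measurableT _ _ (@integrable_cstP 1%R)) => //.
    by apply/measurable_EFinP; exact: measurable_below_mass.
  move=> p _; rewrite /= lee_fin normr1; have /andP[b0 b1] := below_mass01 p.
  by rewrite ger0_norm.
have ik : P.-integrable setT (EFin \o k).
  rewrite (_ : _ \o _ = (fun p => s%:E * (w p)%:E) \- (fun p => s%:E *
      ((below_mass p)%:E + (c p)%:E + (- 2^-1)%:E))); last first.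
    by apply/funext => p; rewrite /k /= EFinB !EFinM !EFinD.
  apply: integrableB => //; apply: integrableZl => //.
  by apply: integrableD => //; [exact: integrableD|exact: integrable_cstP].
have mk : measurable_fun setT k by apply/measurable_EFinP; exact: measurable_int ik.
pose E := [set p | (0 < k p)%R].
have mE : measurable E.
  have m0 : measurable_fun setT (cst 0%R : T -> R) by exact: measurable_cst.
  have := measurable_fun_ltr m0 mk.
  by move=> /(_ measurableT [set true]); rewrite setTI; exact.
have mI : measurable_fun setT (fun p => s * \1_E p)%R.
  by apply: measurable_funM => //; exact: measurable_indic.
have iI f : P.-integrable setT (EFin \o f) ->
    P.-integrable setT (fun p => (f p * (s * \1_E p))%:E).
  move=> if_; have mf : measurable_fun setT f.
    by apply/measurable_EFinP; exact: measurable_int if_.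
  apply: (le_integrable measurableT _ _ (integrableZl measurableT s if_)) => //.
    by apply/measurable_EFinP; exact: measurable_funM.
  move=> p _; rewrite /= lee_fin !normrM mulrC ler_wpM2r//.
  by rewrite ler_piMr// indicE; case: (_ \in _); rewrite ?normr1 ?normr0.
have fint f : P.-integrable setT (EFin \o f) ->
    exists r, \int[P]_p (f p)%:E = r%:E.
  move=> if_; exists (fine (\int[P]_p (f p)%:E)).
  by rewrite fineK//; exact: integrable_fin_num if_.
have i2b1 : P.-integrable setT (EFin \o (fun p => 2 * below_mass p - 1)%R).
  rewrite (_ : _ \o _ = (fun p => 2%:E * (below_mass p)%:E) \+ cst (- 1)%:E).
    by apply: integrableD => //; [exact: integrableZl|exact: integrable_cstP].
  by apply/funext => p /=; rewrite EFinD EFinM.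
have [i1 i1E] := fint _ (iI _ i2b1).
have [i2 i2E] := fint _ (iI _ ic).
have [i3 i3E] := fint _ (iI _ iw).
have [v vE] := fint _ icx.
(* The factor 1/2 in front of [i1] is the 1/4 of the energy times the 2 of [interaction_shift]. *)
have kE : \int[P]_p (k p * \1_E p)%:E = (i3 - (2^-1 * i1 + i2))%:E.
  transitivity (\int[P]_p ((w p * (s * \1_E p))%:E -
      (2^-1%:E * ((2 * below_mass p - 1) * (s * \1_E p))%:E +
      (c p * (s * \1_E p))%:E))).
    apply: eq_integral => p _; rewrite -EFinM -EFinD -?EFinB -?EFinD; congr EFin.
    by rewrite /k; field.
  rewrite integralB//; last 2 first.
  - exact: iI.
  - by apply: integrableD => //; [apply: integrableZl => //|]; exact: iI.
  rewrite integralD//; last 2 first.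
  - by apply: integrableZl => //; exact: iI.
  - exact: iI.
  by rewrite integralZl ?i1E ?i2E ?i3E//; exact: iI.
have := H E mE; rewrite /potential_energy i3E vE.
have -> : \int[P]_p (c p * (x p + s * \1_E p))%:E = (v + i2)%:E.
  rewrite EFinD -vE -i2E -integralD//; last exact: iI.
  by apply: eq_integral => p _; rewrite -EFinD mulrDr.
have := interaction_shift mE.
have -> : \int[P]_p (\1_E p * (s * (2 * below_mass p - 1)))%:E = i1%:E.
  by rewrite -i1E; apply: eq_integral => p _; congr EFin; ring.
(* Both interactions are finite, so the extended real inequalities become inequalities between
   reals. *)
rewrite -(fineK (interaction_fin_num ix)).
rewrite -(fineK (interaction_fin_num (integrable_shift mE))).
move: (fine _) (fine _) => a' a; rewrite -!EFinM -!EFinD -?EFinB !lee_fin => h1 h2.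
have k0 p : (0 <= k p * \1_E p)%R.
  rewrite indicE; have [/set_mem/ltW|] := boolP (p \in E); first by rewrite mulr1.
  by rewrite mulr0.
(* From [h1] and [h2], i3 <= i1 / 2 + i2, so the nonnegative function k 1_E has a nonpositive
   integral. *)
have : \int[P]_p `|(k p * \1_E p)%:E| = 0.
  under eq_integral do rewrite gee0_abs ?lee_fin//.
  apply/eqP; rewrite eq_le integral_ge0 ?andbT//; last first.
    by move=> p _; rewrite lee_fin.
  by rewrite kE lee_fin; lra.
move/ae_eq_integral_abs => /(_ measurableT)[|N [mN N0 NE]].
  apply/measurable_EFinP; apply: measurable_funM => //; exact: measurable_indic.
exists N; split => // p /= /negP; rewrite -ltNge -subr_gt0 -/(k p) => kp.
apply: NE => /= /(_ I) -[]; rewrite indicE mem_set// mulr1 => kp0.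
by move: kp; rewrite kp0 ltxx.
Qed.

End shift_variation.

(** Product measures and Fubini are used for finite measures, whereas the mass of [otimes nu] is
    known only through a hypothesis. The equality of measures allows rewriting one into the
    other. *)
Lemma finite_measure_of_mass1 {R : realType} {d} {T : measurableType d}
    (m : {measure set T -> \bar R}) : m setT = 1%E ->
  exists P : {finite_measure set T -> \bar R}, P = m :> {measure set T -> \bar R}.
Proof.
case: m => m cm mT.
pose pm := Measure_isProbability.Build _ _ _ (Measure.Pack cm) mT.
pose P : probability T R := HB.pack m (Measure.Pack cm) pm.
by exists P.
Qed.

Lemma ae_le_of_shift_variation {R : realType} {d} {T : measurableType d}
    (m : {measure set T -> \bar R}) (x : T -> R) (s : R) (c w : T -> R) :
  m setT = 1%E -> m.-integrable setT (EFin \o x) ->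
  m.-integrable setT (EFin \o c) ->
  m.-integrable setT (EFin \o (c \* x)) ->
  m.-integrable setT (EFin \o w) ->
  (forall E, measurable E -> (\int[m]_p (w p * (s * \1_E p))%:E <=
    potential_energy m c (fun p => x p + s * \1_E p)%R -
    potential_energy m c x)%E) ->
  \forall p \ae m, s * w p <= s * (below_mass m x s p + c p - 2^-1).
Proof.
move=> mT; have [P Pm] := finite_measure_of_mass1 mT.
rewrite -Pm in mT * => ix ic icx iw H.
exact: (ae_le_of_shift_variation_finite mT ix ic icx iw).
Qed.

(** * Image measures and supports *)

Definition pushforward_measure {d1 d2} {T1 : measurableType d1}
    {T2 : measurableType d2} {R : realType} (m : {measure set T1 -> \bar R})
    (F : T1 -> T2) (mF : measurable_fun setT F) : {measure set T2 -> \bar R} :=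
  measure_function_pushforward__canonical__measure_function_Measure m mF.

Section pushforward_theory.
Local Open Scope ereal_scope.
Context {d1 d2} {T1 : measurableType d1} {T2 : measurableType d2} {R : realType}.

Lemma measurable_integral_pushforward (m : {measure set T1 -> \bar R})
    (F : T1 -> T2) (f : T2 -> \bar R) :
  measurable_fun setT F -> measurable_fun setT f ->
  \int[pushforward m F]_y f y = \int[m]_x f (F x).
Proof.
move=> mF mf; rewrite [LHS]integralE [RHS]integralE; congr (_ - _).
- rewrite ge0_integral_pushforward//; last exact: measurable_funepos.
  by apply: eq_integral => x _; rewrite /= !funeposE.
- rewrite ge0_integral_pushforward//; last exact: measurable_funeneg.
  by apply: eq_integral => x _; rewrite /= !funenegE.
Qed.

End pushforward_theory.

Section support.
Context {R : realType}.
Implicit Types m : {measure set R -> \bar R}.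

(** A point outside the support has a null open neighbourhood, hence lies in a null interval with
    rational endpoints. There are countably many of these. *)
Lemma measure_setC_supp m (a b : R) :
  measure_supp m `<=` `[a, b]%classic -> m (~` `[a, b]%classic) = 0%E.
Proof.
move=> suppab; set U := ~` _.
(* [F] enumerates the null rational intervals; codes of other intervals, and codes of nothing, give
   the empty set. *)
pose F n : set R := if unpickle n is Some (q1, q2) then
  if m `](ratr q1 : R), ratr q2[%classic == 0%E
  then `](ratr q1 : R), ratr q2[%classic else set0 else set0.
have nF : m.-negligible (\bigcup_k F k).
  apply: negligible_bigcup => k; rewrite /F.
  case: (unpickle k) => [[q1 q2]|]; last exact: negligible_set0.
  case: ifPn => [/eqP m0|_]; last exact: negligible_set0.
  by apply/negligibleP.
have mU : measurable U by exact: measurableC.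
apply: measure_negligible => //; apply: negligibleS nF => x Ux.
have : ~ measure_supp m x by move=> /suppab.
move=> /existsNP[V] /not_implyP[oV] /not_implyP[Vx] /negP mV.
have {mV} V0 : m V = 0%E by apply/eqP; rewrite -measure_le0 leNgt.
have /nbhs_ballP[e /= e0 eV] : nbhs x V by exact: open_nbhs_nbhs.
have [q1 q1P] : exists q, ratr q \in `](x - e), x[ by apply: rat_in_itvoo; lra.
have [q2 q2P] : exists q, ratr q \in `]x, (x + e)[ by apply: rat_in_itvoo; lra.
have {q1P}/andP[q1l q1r] : x - e < ratr q1 < x by move: q1P; rewrite in_itv.
have {q2P}/andP[q2l q2r] : x < ratr q2 < x + e by move: q2P; rewrite in_itv.
have m0 : m `](ratr q1 : R), ratr q2[%classic = 0%E.
  apply/eqP; rewrite -measure_le0 -V0 le_measure ?inE//; first exact: open_measurable.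
  move=> y /=; rewrite in_itv/= => /andP[y1 y2]; apply: eV.
  by rewrite /ball/= ltr_norml; apply/andP; split; lra.
exists (pickle (q1, q2)); first exact: I.
by rewrite /F pickleK m0 eqxx /= in_itv/= q1r q2l.
Qed.

Lemma measure_supp_sub m (a b : R) :
  m (~` `[a, b]%classic) = 0%E -> measure_supp m `<=` `[a, b]%classic.
Proof.
move=> m0 x xm; apply: contrapT => xab.
have : (0 < m (~` `[a, b]%classic))%E.
  by apply: xm => //; apply: closed_openC; exact: interval_closed.
by rewrite m0 ltxx.
Qed.

End support.

Lemma interaction_pushforward {R : realType} {d} {T : measurableType d}
    (m : {measure set T -> \bar R}) (F : T -> R) :
  m setT = 1%E -> measurable_fun setT F ->
  (\int[pushforward m F]_x \int[pushforward m F]_y `|x - y|%:E =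
  interaction m F)%E.
Proof.
move=> mT mF; have [P Pm] := finite_measure_of_mass1 mT; rewrite -{}Pm in mT *.
have md : measurable_fun setT (fun z : R * R => `|z.1 - z.2|%:E).
  apply/measurable_EFinP; apply: measurableT_comp => //.
  exact: measurable_funB.
have mdF : measurable_fun setT (fun z : R * T => `|z.1 - F z.2|%:E).
  apply/measurable_EFinP; apply: measurableT_comp => //.
  by apply: measurable_funB => //; exact: measurableT_comp.
(* The change of variables is made in the inner integral first, then in the outer one. *)
transitivity (\int[pushforward P F]_x \int[P]_q `|x - F q|%:E)%E.
  apply: eq_integral => // x _; apply: measurable_integral_pushforward => //.
  exact: (measurableT_comp md (pair1_measurable x)).
apply: (@measurable_integral_pushforward _ _ _ _ _ P F
  (fun x => \int[P]_q `|x - F q|%:E)%E) => //.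
exact: (measurable_fun_fubini_tonelli_F (m2 := P)
  (fun z : R * T => `|z.1 - F z.2|%:E) mdF).
Qed.

(** * Images of a family, and Fubini for nu (x) mu *)

Section push_family.
Local Open Scope ereal_scope.
Context {R : realType} (mu : {measure set R -> \bar R}) (Rv : R).
Local Notation A := (vel_set Rv).
Variable nu : mufamily mu Rv R.

Let mA : measurable A. Proof. exact: measurable_itv. Qed.

Section push.
Context {d} {S : measurableType d} (F : R * R -> S).
Hypothesis mF : measurable_fun setT F.

Let mFa a : measurable_fun setT (fun x => F (a, x)).
Proof. exact: measurableT_comp mF (pair1_measurable a). Qed.

Let mpreimage B : measurable B -> measurable (F @^-1` B).
Proof. by move=> mB; rewrite -[_ @^-1` _]setTI; exact: mF. Qed.

Let push_fam a := pushforward_measure (nu a) (mFa a).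

Let push_fam_measurable B : measurable B ->
  mu_measurable mu A (fun a => push_fam a B).
Proof.
move=> mB; have := mu_measurable_xsection nu (mpreimage mB).
rewrite (_ : (fun a => nu a _) = (fun a => push_fam a B))//.
by apply/funext => a; rewrite xsectionE.
Qed.

(** The map may depend on a, as a shift on a Borel set of pairs does. The target S is left general:
    R gives the perturbed family, R x R the coupling with it. *)
Definition push_family : mufamily mu Rv S :=
  MuFamily push_fam_measurable (fam_finite nu).

Lemma integral_push_family a (f : S -> \bar R) : measurable_fun setT f ->
  \int[push_family a]_y f y = \int[nu a]_x f (F (a, x)).
Proof. exact: measurable_integral_pushforward. Qed.

End push.

(** The copy of [nu a] on the line {a} x R. It exhibits [otimes nu] as a mixture of measures on the
    plane. *)
Let K a := pushforward_measure (nu a) (pair1_measurable a).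

Let mK B : measurable B -> mu_measurable mu A (fun a => K a B).
Proof.
move=> /(mu_measurable_xsection nu); congr mu_measurable.
by apply/funext => a; rewrite xsectionE.
Qed.

Let KM B : measurable B -> \int[mu]_(a in A) K a B = otimes nu B.
Proof. by move=> _; apply: eq_integral => a _; rewrite xsectionE. Qed.

Let integralK a (f : R * R -> \bar R) : measurable_fun setT f ->
  \int[K a]_p f p = \int[nu a]_x f (a, x).
Proof.
by move=> mf; apply: measurable_integral_pushforward => //; exact: pair1_measurable.
Qed.

Lemma otimes_ge0_integral (f : R * R -> \bar R) :
  measurable_fun setT f -> (forall p, 0 <= f p) ->
  \int[mu]_(a in A) \int[nu a]_x f (a, x) = \int[otimes nu]_p f p.
Proof.
move=> mf f0; rewrite -(mixture_ge0 mA mK KM mf f0).2.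
by apply: eq_integral => a _; rewrite integralK.
Qed.

Lemma otimes_integral (f : R * R -> \bar R) :
  (otimes nu).-integrable setT f ->
  \int[mu]_(a in A) \int[nu a]_x f (a, x) = \int[otimes nu]_p f p.
Proof.
move=> intf; rewrite -(mixture_integrable mA mK KM intf).
by apply: eq_integral => a _; rewrite integralK//; exact: measurable_int intf.
Qed.

Lemma marginalE B : marginal nu B = otimes nu (snd @^-1` B).
Proof. by apply: eq_integral => a _; rewrite xsectionE. Qed.

Lemma marginal_push_family (F : R * R -> R) (mF : measurable_fun setT F) B :
  marginal (push_family mF) B = otimes nu (F @^-1` B).
Proof. by apply: eq_integral => a _; rewrite xsectionE. Qed.

Lemma energy_push_family (F : R * R -> R) (mF : measurable_fun setT F) :
  otimes nu setT = 1 ->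
  (otimes nu).-integrable setT (fun p => ((2^-1 - p.1) * F p)%:E) ->
  energy (push_family mF) =
  potential_energy (otimes nu) (fun p => 2^-1 - p.1)%R F.
Proof.
move=> mass1 intF; rewrite /energy /potential_energy; congr (_ * _ + _).
- have mE : marginal (push_family mF) = pushforward (otimes nu) F.
    by apply/funext => B; exact: marginal_push_family.
  by rewrite -interaction_pushforward//= mE.
- rewrite -(otimes_integral intF); apply: eq_integral => a _.
  rewrite integral_push_family//; apply/measurable_EFinP.
  exact: measurable_funM.
Qed.

(** The case where nothing moves: the image of [nu] under the second projection is [nu]. *)
Lemma energy_otimes :
  otimes nu setT = 1 ->
  (otimes nu).-integrable setT (fun p => ((2^-1 - p.1) * p.2)%:E) ->
  energy nu = potential_energy (otimes nu) (fun p => 2^-1 - p.1)%R snd.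
Proof. by move=> mass1 intF; rewrite -(energy_push_family measurable_snd). Qed.

End push_family.

Lemma ae_bounded_integrable {R : realType} {d} {T : measurableType d}
    (m : {measure set T -> \bar R}) (f : T -> R) (k : R) :
  m setT = 1%E -> measurable_fun setT f -> 0 <= k ->
  (\forall p \ae m, `|f p| <= k) -> m.-integrable setT (EFin \o f).
Proof.
move=> mT mf k0 fk; apply/integrableP; split; first exact/measurable_EFinP.
apply: (@le_lt_trans _ _ (k%:E * m setT)%E); last by rewrite mT mule1 ltry.
apply: integral_le_bound => //; first exact/measurable_EFinP.
by apply: filterS fk => p fp _; rewrite lee_fin.
Qed.

(** * Mass and essential bounds for nu (x) mu *)

Section otimes_bounds.
Local Open Scope ereal_scope.
Context {R : realType} (mu : {measure set R -> \bar R}) (Rv : R).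
Local Notation A := (vel_set Rv).
Variables (h : R -> R) (nu : mufamily mu Rv R).

Let mA : measurable A. Proof. exact: measurable_itv. Qed.

(** The mass is the integral of h over A, which is its integral over R because h vanishes off A.
    That is the total mass of [eta0 f0], an image of a probability. *)
Lemma otimes_mass1 (f0 : probability (R * R)%type R) :
  is_density mu (pushforward (eta0 f0) snd) h ->
  (forall a, ~ A a -> h a = 0%R) -> X_space h nu -> otimes nu setT = 1.
Proof.
move=> [mh h0 /(_ _ measurableT) hT] hout [nuT _].
transitivity (\int[mu]_(a in A) nu a setT).
  by apply: eq_integral => a _; rewrite xsectionE.
rewrite (eq_integral_ae nuT) integral_mkcond.
transitivity (\int[mu]_a (h a)%:E).
  apply: eq_integral => a _; rewrite patchE; case: ifPn => //.
  by move=> /negP aA; rewrite hout// => Aa; apply: aA; exact: mem_set.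
by rewrite -hT; exact: (probability_setT f0).
Qed.

Lemma otimes_ae_fst : \forall p \ae otimes nu, A p.1.
Proof.
have mN : measurable (fst @^-1` (~` A) : set (R * R)).
  by rewrite -[X in measurable X]setTI; apply: measurable_fst => //; exact: measurableC.
exists (fst @^-1` (~` A)); split => //.
rewrite /= /otimes integral0_eq// => a Aa.
rewrite [X in nu a X](_ : _ = set0) ?measure0// xsectionE.
by apply/seteqP; split => // x.
Qed.

Lemma otimes_ae_snd r : X_ball h r nu -> \forall p \ae otimes nu, (`|p.2| <= r)%R.
Proof.
move=> [_ suppr].
have mI : measurable (~` `[(- r)%R, r]%classic : set R) by exact: measurableC.
have mN : measurable (snd @^-1` (~` `[(- r)%R, r]%classic) : set (R * R)).
  by rewrite -[X in measurable X]setTI; exact: measurable_snd.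
exists (snd @^-1` (~` `[(- r)%R, r]%classic)); split => //.
  rewrite /= -marginalE /marginal (eq_integral_ae (g := cst 0)) ?integral0//.
  by apply: filterS suppr => a + Aa => /(_ Aa); exact: measure_setC_supp.
by move=> p /= np; apply: contra_not np; rewrite in_itv/= ler_norml.
Qed.

End otimes_bounds.

(** * Perturbed families as competitors in the subdifferential inequality *)

Section shifted_family.
Local Open Scope ereal_scope.
Context {R : realType} (mu : {measure set R -> \bar R}) (Rv : R).
Local Notation A := (vel_set Rv).
Variables (h : R -> R) (nu : mufamily mu Rv R).
Variables (r : R) (F : R * R -> R) (mF : measurable_fun setT F).
Hypotheses (mass1 : otimes nu setT = 1) (nuX : X_ball h r nu).

Lemma X_ball_push_family r' : (0 <= r')%R ->
  (forall a x, (`|x| <= r -> `|F (a, x)| <= r')%R) ->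
  X_ball h r' (push_family nu mF).
Proof.
move=> r'0 Fr'; have [[nuT _] suppr] := nuX; split; last first.
  apply: filterS suppr => a + Aa => /(_ Aa)/measure_setC_supp nu0.
  have mFa : measurable_fun setT (fun x => F (a, x)).
    exact: measurableT_comp mF (pair1_measurable a).
  have mI s : measurable (~` `[(- s)%R, s]%classic : set R) by exact: measurableC.
  apply: measure_supp_sub; apply: (subset_measure0 _ (mI r) _ nu0).
    by rewrite -[X in measurable X]setTI; exact: mFa.
  move=> x /=; rewrite !in_itv/= -!ler_norml => nF; apply: contra_not nF.
  exact: Fr'.
split; first exact: nuT.
have mF2 : measurable_fun setT (fun p => (F p ^+ 2)%:E).
  by apply/measurable_EFinP; exact: measurable_funX.
(* The second moment is finite because F^2 is a.e. at most r'^2 and the mass is 1. *)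
rewrite (_ : \int[mu]_(a in A) _ = \int[otimes nu]_p (F p ^+ 2)%:E).
  have : (otimes nu).-integrable setT (EFin \o (fun p => F p ^+ 2)%R).
    apply: (@ae_bounded_integrable _ _ _ _ _ (r' ^+ 2)) => //.
    - exact/measurable_EFinP.
    - exact: sqr_ge0.
    - apply: filterS (otimes_ae_snd nuX) => -[a x] /= /(Fr' a) Fx.
      by rewrite normrX lerXn2r// ?nnegrE.
  exact: integrable_lty.
rewrite -otimes_ge0_integral//; last by move=> p; rewrite lee_fin sqr_ge0.
apply: eq_integral => a _; rewrite integral_push_family//.
by apply/measurable_EFinP; exact: measurable_funX.
Qed.

Let mF2 : measurable_fun setT (fun p => (p.2, F p)).
Proof. exact: measurable_fun_pair. Qed.

(** The coupling is deterministic, carried by the graph of F(a, .), so z - y becomes the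
    displacement [F p - p.2] in the subdifferential inequality. *)
Lemma coupling_family_push :
  coupling_family nu (push_family nu mF) (push_family nu mF2).
Proof. by apply: aeW => a Aa B mB; split. Qed.

Lemma subdifferential_push_family (w : R * R -> R) (r' : R) :
  subdifferential h nu w -> (0 < r')%R -> X_ball h r' (push_family nu mF) ->
  (otimes nu).-integrable setT (fun p => (w p * (F p - p.2))%:E) ->
  \int[otimes nu]_p (w p * (F p - p.2))%:E <=
    energy (push_family nu mF) - energy nu.
Proof.
move=> [wL1 wJ] r'0 thX iwF.
have /Lfun1_integrable/measurable_int/measurable_EFinP mw := wL1.
apply: le_trans (wJ _ _ _ r'0 thX coupling_family_push).
rewrite -otimes_integral// le_eqVlt; apply/orP; left; apply/eqP.
apply: eq_integral => a _; rewrite integral_push_family//=.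
apply/measurable_EFinP; apply: measurable_funM; last exact: measurable_funB.
have mwa : measurable_fun setT (fun x => w (a, x)).
  exact: measurableT_comp mw (pair1_measurable a).
exact: (measurableT_comp mwa measurable_fst).
Qed.

End shifted_family.

(** * One-sided limits of distribution functions *)

Section cdf_limits.
Context {R : realType} (m : {measure set R -> \bar R}).
Hypothesis mfin : (m setT < +oo)%E.

Let m_fin B : measurable B -> m B \is a fin_num.
Proof.
move=> mB; rewrite ge0_fin_numE//; apply: le_lt_trans mfin.
by apply: le_measure => //; rewrite inE.
Qed.

(** Continuity from above: the half-line closed at x is the decreasing intersection of the
    half-lines open at x + 1/(n+1). *)
Lemma le_cdf_of_cdf_left (x b : R) :
  (forall n : nat, b <= cdf_left_of m (x + n.+1%:R^-1)) -> b <= cdf_of m x.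
Proof.
move=> bn; rewrite -lee_fin fineK; last exact: m_fin.
pose F n := `]-oo, (x + n.+1%:R^-1)[%classic : set R.
have mF n : measurable (F n) by exact: measurable_itv.
have FI : \bigcap_n F n = `]-oo, x]%classic.
  apply/seteqP; split => y /=; rewrite in_itv/=; last first.
    by move=> yx n _; rewrite /F /= in_itv/= (le_lt_trans yx)// ltrDl invr_gt0.
  move=> Fy; rewrite leNgt; apply/negP => xy.
  have /ltr_add_invr[n] := xy.
  by have := Fy n I; rewrite /F /= in_itv/= => /lt_trans /[apply]; rewrite ltxx.
have : m \o F @ \oo --> m (\bigcap_n F n).
  apply: nonincreasing_cvg_mu => //.
  - by rewrite -ge0_fin_numE//; exact: m_fin.
  - by rewrite FI.
  - move=> n k nk; apply/subsetPset => y; rewrite /F /= !in_itv/= => /lt_le_trans.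
    by apply; rewrite lerD2l lef_pV2 ?posrE// ler_nat.
rewrite FI => /[dup] /cvg_lim <- //; first last.
move=> /cvgP cF; apply: lime_ge => //; apply: nearW => n.
by rewrite /= -[leRHS]fineK ?lee_fin ?bn//; exact: m_fin.
Qed.

(** Continuity from below: the half-line open at x is the increasing union of the half-lines open at
    x - 1/(n+1). *)
Lemma cdf_left_of_le (x b : R) :
  (forall n : nat, cdf_left_of m (x - n.+1%:R^-1) <= b) -> cdf_left_of m x <= b.
Proof.
move=> bn; rewrite -lee_fin fineK; last exact: m_fin.
pose F n := `]-oo, (x - n.+1%:R^-1)[%classic : set R.
have mF n : measurable (F n) by exact: measurable_itv.
have FU : \bigcup_n F n = `]-oo, x[%classic.
  apply/seteqP; split => y /=; rewrite in_itv/=.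
    by move=> [n _]; rewrite /F /= in_itv/= => /lt_trans; apply; rewrite gtrBl invr_gt0.
  move=> /ltr_add_invr[n yn]; exists n => //.
  by rewrite /F /= in_itv/= ltrBrDr.
have : m \o F @ \oo --> m (\bigcup_n F n).
  apply: nondecreasing_cvg_mu => //.
  - by rewrite FU.
  - move=> n k nk; apply/subsetPset => y; rewrite /F /= !in_itv/= => /lt_le_trans.
    by apply; rewrite lerD2l lerN2 lef_pV2 ?posrE// ler_nat.
rewrite FU => /[dup] /cvg_lim <- //; first last.
move=> /cvgP cF; apply: lime_le => //; apply: nearW => n.
by rewrite /= -[leLHS]fineK ?lee_fin ?bn//; exact: m_fin.
Qed.

Lemma cdf_left_of_ge0 x : 0 <= cdf_left_of m x.
Proof. by rewrite fine_ge0. Qed.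

Lemma cdf_of_le x : cdf_of m x <= fine (m setT).
Proof.
by apply: fine_le; rewrite ?m_fin// le_measure ?inE//; exact: measurable_itv.
Qed.

End cdf_limits.

(** * Bounds for the elements of the subdifferential *)

Lemma norm_half_sub_le {R : realFieldType} (b a : R) :
  - b <= a <= b + 1 -> `|2^-1 - a| <= b + 2.
Proof. by move=> /andP[a1 a2]; rewrite ler_norml; apply/andP; split; lra. Qed.

Section subdifferential_bound.
Context {R : realType} (mu : {measure set R -> \bar R}) (Rv : R).
Variables (h : R -> R) (nu : mufamily mu Rv R) (r : R) (w : R * R -> R).
Hypotheses (Rv0 : 0 < Rv) (r0 : 0 < r).
Hypotheses (mass1 : otimes nu setT = 1%E) (nuX : X_ball h r nu).
Hypothesis (wJ : subdifferential h nu w).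

Lemma subdifferential_shift_ae (s : R) :
  \forall p \ae otimes nu,
    s * w p <= s * (cdf_left_of (marginal nu) (p.2 + s) - p.1).
Proof.
have iw : (otimes nu).-integrable setT (EFin \o w).
  by apply/Lfun1_integrable; exact: wJ.1.
have mw : measurable_fun setT w by apply/measurable_EFinP; exact: measurable_int iw.
pose c (p : R * R) : R := 2^-1 - p.1.
have mc : measurable_fun setT c by exact: measurable_funB.
have cb : \forall p \ae otimes nu, `|c p| <= Rv + 2.
  apply: filterS (otimes_ae_fst nu) => p; rewrite /vel_set /= in_itv/=.
  exact: norm_half_sub_le.
have Rv2 : 0 <= Rv + 2 by rewrite addr_ge0// ltW.
have xb := otimes_ae_snd nuX.
have bint := ae_bounded_integrable mass1.
have ix : (otimes nu).-integrable setT (EFin \o snd).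
  by apply: (bint snd r) => //; exact: ltW.
have ic : (otimes nu).-integrable setT (EFin \o c) by exact: (bint _ (Rv + 2)).
have icF (F : R * R -> R) (k : R) : measurable_fun setT F -> 0 <= k ->
    (\forall p \ae otimes nu, `|F p| <= k) ->
    (otimes nu).-integrable setT (EFin \o (c \* F)).
  move=> mF k0 Fk; apply: (bint _ ((Rv + 2) * k)); first exact: measurable_funM.
    exact: mulr_ge0.
  by apply: filterS2 cb Fk => p cp Fp; rewrite normrM ler_pM.
have icx := icF snd r measurable_snd (ltW r0) xb.
(* The competitor moves the mass in E by s. Its fibres are supported in [-(r + |s|), r + |s|], so it
   is admissible. *)
have H E : measurable E -> (\int[otimes nu]_p (w p * (s * \1_E p))%:E <=
    potential_energy (otimes nu) c (fun p => p.2 + s * \1_E p)%R -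
    potential_energy (otimes nu) c snd)%E.
  move=> mE; have mI : measurable_fun setT (fun p => s * \1_E p).
    by apply: measurable_funM => //; exact: measurable_indic.
  have mF : measurable_fun setT (fun p : R * R => p.2 + s * \1_E p).
    exact: measurable_funD.
  have Is p : `|s * \1_E p| <= `|s|.
    rewrite normrM ler_piMr// indicE; case: (_ \in _); by rewrite ?normr1 ?normr0.
  have r'0 : 0 < r + `|s| by exact: ltr_pwDl.
  have Fb p : `|p.2| <= r -> `|p.2 + s * \1_E p| <= r + `|s|.
    by move=> pr; apply: le_trans (ler_normD _ _) _; exact: lerD.
  have thX : X_ball h (r + `|s|) (push_family nu mF).
    apply: (X_ball_push_family mF mass1 nuX (ltW r'0)) => a x.
    exact: (Fb (a, x)).
  have wE : (fun p => (w p * (p.2 + s * \1_E p - p.2))%:E) =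
            (fun p => (w p * (s * \1_E p))%:E).
    by apply/funext => p; congr EFin; ring.
  have := subdifferential_push_family wJ r'0 thX; rewrite wE.
  rewrite energy_push_family//; last first.
    by apply: (icF _ (r + `|s|) mF (ltW r'0)); exact: filterS xb.
  rewrite energy_otimes//; apply.
  apply: (le_integrable measurableT _ _ (integrableZl measurableT s iw)) => //.
    by apply/measurable_EFinP; exact: measurable_funM.
  by move=> p _; rewrite /= lee_fin normrM mulrC [leRHS]normrM ler_wpM2r.
apply: filterS (ae_le_of_shift_variation mass1 ix ic icx iw H) => p.
(* The 1/2 in c = 1/2 - a cancels the -1/2 left by the interaction. *)
rewrite (_ : below_mass _ _ _ _ = cdf_left_of (marginal nu) (p.2 + s)).
  by rewrite /c => /le_trans; apply; rewrite le_eqVlt; apply/orP; left; apply/eqP; ring.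
by rewrite /below_mass /cdf_left_of marginalE; congr (fine (otimes nu _)).
Qed.

Lemma subdifferential_ae_bounds :
  \forall p \ae otimes nu,
    cdf_left_of (marginal nu) p.2 - p.1 <= w p <= cdf_of (marginal nu) p.2 - p.1.
Proof.
have mfin : (marginal nu setT < +oo)%E by rewrite marginalE /= mass1 ltry.
(* Only countably many shifts are used, so one null set serves for all n. Division by s gives upper
   bounds for s > 0 and, reversing the inequality, lower bounds for s < 0. *)
have up := ae_foralln (fun n : nat => subdifferential_shift_ae n.+1%:R^-1).
have lo := ae_foralln (fun n : nat => subdifferential_shift_ae (- n.+1%:R^-1)).
apply: filterS2 up lo => p up lo; apply/andP; split.
  rewrite lerBlDr; apply: cdf_left_of_le => // n.
  by have := lo n; rewrite !mulNr lerN2 ler_pM2l ?invr_gt0// lerBlDr.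
rewrite lerBrDr; apply: le_cdf_of_cdf_left => // n.
by have := up n; rewrite ler_pM2l ?invr_gt0// lerBrDr.
Qed.

(** Since 0 <= G^-, G <= 1 and -Rv <= a <= Rv + 1, the two bounds even place w in
    [-(Rv + 1), Rv + 1]. *)
Lemma subdifferential_ae_norm : \forall p \ae otimes nu, `|w p| <= Rv + 2.
Proof.
have mfin : (marginal nu setT < +oo)%E by rewrite marginalE /= mass1 ltry.
apply: filterS2 subdifferential_ae_bounds (otimes_ae_fst nu) => p /andP[lo up].
rewrite /vel_set /= in_itv/= => /andP[a1 a2].
have G0 := cdf_left_of_ge0 (marginal nu) p.2.
have G1 : cdf_of (marginal nu) p.2 <= fine 1%E.
  have <- : marginal nu setT = 1%E by rewrite marginalE; exact: mass1.
  exact: cdf_of_le.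
rewrite /= in G1.
move: lo up G0 G1; move: (cdf_of _ _) (cdf_left_of _ _) (w p) p.1 a1 a2 => *.
by rewrite ler_norml; apply/andP; split; lra.
Qed.

End subdifferential_bound.

Theorem proposition3p7 (R : realType) (Rx Rv : R)
    (f0 : probability (R * R)%type R)
    (mu : {sigma_finite_measure set R -> \bar R}) (h : R -> R)
    (Rx_gt0 : 0 < Rx) (Rv_gt0 : 0 < Rv)
    (f0_supp : measure_supp f0 `<=` `[- Rx, Rx]%classic `*` `[- Rv, Rv]%classic)
    (rho0_atomless : atomless (pushforward f0 fst))
    (h_density : is_density mu (pushforward (eta0 f0) snd) h)
    (h_out : forall a, ~ vel_set Rv a -> h a = 0)
    (r : R) (r_gt0 : 0 < r)
    (nu : mufamily mu Rv R) (nuX : X_ball h r nu)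
    (w : R * R -> R) (wJ : subdifferential h nu w) :
  let rho := marginal nu in
  let G := cdf_of rho in
  let G_left := cdf_left_of rho in
  (\forall p \ae otimes nu, G_left p.2 - p.1 <= w p <= G p.2 - p.1) /\
  w \in Lfun (otimes nu) +oo%E /\
  ('N[otimes nu]_+oo%E [EFin \o w] <= (Rv + 2)%:E)%E.
Proof.
move=> rho G G_left.
have mass1 := otimes_mass1 h_density h_out nuX.1.
have N : ('N[otimes nu]_+oo%E [EFin \o w] <= (Rv + 2)%:E)%E.
  (* The norm of exponent +oo is the essential supremum only when the total mass is positive, which
     [mass1] provides. *)
  rewrite unlock /= mass1 lte01; apply/ess_supP.
  apply: filterS (subdifferential_ae_norm Rv_gt0 r_gt0 mass1 nuX wJ) => p wp.
  by rewrite /= lee_fin.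
split; first exact: (subdifferential_ae_bounds Rv_gt0 r_gt0 mass1 nuX wJ).
split => //; have /andP[mw _] := wJ.1.
rewrite inE; apply/andP; split; first exact: mw.
by rewrite inE; exact: le_lt_trans N (ltry _).
Qed.
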